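(* Assume (A1)–(A5). For $n\in\mathbb N$ and $v\in\mathrm{Dom}(\mathcal R)$ set $$J_n(v):=\begin{cases}J\Big(\frac1n\sum_{j=1}^n (c^j)^2u^j\Big), & \text{if } v=\frac1n\sum_{j=1}^n (c^j)^2u^j \text{ for some } (c^1,\dots,c^n)\in[0,\infty)^n,\ (u^1,\dots,u^n)\in\tilde{\mathcal B}^n,\\ +\infty,&\text{otherwise.}\end{cases}$$ Then, with respect to the weak$^*$-topology on $\mathrm{Dom}(\mathcal R)$, $J_n$ $\Gamma$-converges to $J$ as $n\to\infty$, i.e.: ($\Gamma$-liminf) For every sequence $(v_n)_{n\in\mathbb N}\subset\mathrm{Dom}(\mathcal R)$ with $v_n\stackrel{*}{\rightharpoonup}v\in\mathrm{Dom}(\mathcal R)$ it holds that $J(v)\le\liminf_{n\to\infty}J_n(v_n)$. ($\Gamma$-limsup) For each $v\in\mathrm{Dom}(\mathcal R)$ there exists a sequence $(v_n)_{n\in\mathbb N}\subset\mathrm{Dom}(\mathcal R)$ with $v_n\stackrel{*}{\rightharpoonup}v$ such that $\limsup_{n\to\infty}J_n(v_n)\le J(v)$. Moreover, this sequence can be taken such that for every $n\in\mathbb N$ there are $(\tilde c_n^j)_{j=1}^n\subset[0,\sqrt{n\mathcal R(v)}]$ and $(\tilde u_n^j)_{j=1}^n\subset\tilde{\mathcal B}$ with $$v_n=\frac1n\sum_{j=1}^n(\tilde c_n^j)^2\tilde u_n^j\quad\text{and}\quad \frac1n\sum_{j=1}^n(\tilde c_n^j)^2\le\mathcal R(v).$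$
   Context: Let $\mathcal C$ be a separable Banach space, $\mathcal M=\mathcal C^*$ its topological dual with the dual norm, and $Y$ a Hilbert space. Let $K:\mathcal M\to Y$, $\mathcal F:Y\to\mathbb R$, $\mathcal R:\mathcal M\to[0,+\infty]$ and $J(u):=\mathcal F(Ku)+\mathcal R(u)$ for $u\in\mathcal M$. Put $\mathrm{Dom}(\mathcal R):=\{u\in\mathcal M:\mathcal R(u)<+\infty\}$. Assumptions: (A1) $K$ is linear and weak$^*$-to-weak continuous. (A2) $\mathcal F$ is bounded from below, convex, and twice Fréchet differentiable on $Y$. (A3) $\mathcal R$ is convex, weak$^*$-lower semicontinuous and positively one-homogeneous: $\mathcal R(\lambda u)=\lambda\mathcal R(u)$ for all $\lambda\ge0$, $u\in\mathcal M$. (A4) For every $\alpha\ge0$ the sublevel set $\{u\in\mathcal M:\mathcal R(u)\le\alpha\}$ is weak$^*$-compact. (A5) $K$ is sequentially weak$^*$-to-strong continuous on $\mathrm{Dom}(\mathcal R)$. Let $B:=\{u\in\mathcal M:\mathcal R(u)\le1\}$, let $\mathrm{Ext}(B)$ be the set of its extremal points, and let $\tilde{\mathcal B}:=\overline{\mathrm{Ext}(B)}^{*}$ be the weak$^*$-closure of $\mathrm{Ext}(B)$. *)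

(* Defs.v *)
From HB Require Import structures.
From mathcomp Require Import all_boot all_order all_algebra.
From mathcomp Require Import sesquilinear.
From mathcomp Require Import all_classical all_reals all_analysis.

Set Implicit Arguments.
Unset Strict Implicit.
Unset Printing Implicit Defensive.
Import Order.TTheory GRing.Theory Num.Theory.
Import numFieldNormedType.Exports.

Local Open Scope classical_set_scope.
Local Open Scope ring_scope.

(******************************************************************************)
(* Topological dual of a normed space                                         *)
(*       dual V == the type of continuous linear functionals on V, a          *)
(*                 normedModType for the operator norm                        *)
(*   weakstar V == dual V with the weak* topology                             *)
(*       weak V == V with its weak topology                                   *)
(******************************************************************************)

Section Dual.
Context {R : realType} (V : normedModType R).

Definition dual_functional : {pred V -> R^o} :=
  [pred f | `[< linear f /\ continuous f >]].

Record dual : Type := Dual {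
  dual_fun :> V -> R^o;
  dual_subproof : dual_fun \in dual_functional }.

Lemma dual_functional_submod_closed : submod_closed dual_functional.
Proof.
split=> [|a f g /asboolP[lf cf] /asboolP[lg cg]]; apply/asboolP; split.
- by move=> a u v /=; rewrite scaler0 addr0.
- exact: cst_continuous.
- move=> b u v; rewrite -[LHS]/(a *: f (b *: u + v) + g (b *: u + v)) lf lg.
  rewrite -[RHS]/(b *: (a *: f u + g u) + (a *: f v + g v)).
  by rewrite !scalerDr !scalerA mulrC addrACA.
- move=> x; apply: (@continuousD _ _ _ (a *: f) g); last exact: cg.
  exact: continuousZr (cf x).
Qed.

HB.instance Definition _ := GRing.isSubmodClosed.Build _ _ dual_functional
  dual_functional_submod_closed.

HB.instance Definition _ := [isSub for dual_fun].
HB.instance Definition _ := [Choice of dual by <:].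
HB.instance Definition _ := [SubChoice_isSubLmodule of dual by <:].

Implicit Types f g : dual.

Lemma dual_linear f : linear f.
Proof. by case: f => f /= /asboolP[]. Qed.

HB.instance Definition _ f := GRing.isLinear.Build R V R^o *:%R (f : V -> R^o)
  (dual_linear f).

Lemma dual_continuous f : continuous f.
Proof. by case: f => f /= /asboolP[]. Qed.

Lemma dualP f g : f =1 g -> f = g.
Proof. by move=> fg; apply: val_inj; apply/funext. Qed.

Definition dual_ball_values f : set R := [set `|f x| | x in [set x | `|x| <= 1]].

Definition dual_norm f : R := sup (dual_ball_values f).

Lemma has_sup_dual_ball_values f : has_sup (dual_ball_values f).
Proof.
split; first by exists `|f 0|; exists 0 => //=; rewrite normr0.
have /continuous_linear_bounded/linear_boundedP : {for 0, continuous f}.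
  exact: dual_continuous.
move=> /pinfty_ex_gt0[r r0 fr]; exists r => _ [x /= x1 <-].
by rewrite (le_trans (fr x))// ler_piMr// ltW.
Qed.

Lemma dual_norm_ub f x : `|x| <= 1 -> `|f x| <= dual_norm f.
Proof.
by move=> x1; apply: sup_upper_bound;
  [exact: has_sup_dual_ball_values|exists x].
Qed.

Lemma dual_norm_le f r : (forall x, `|x| <= 1 -> `|f x| <= r) ->
  dual_norm f <= r.
Proof.
move=> fr; apply: sup_le_ub; first by case: (has_sup_dual_ball_values f).
by move=> _ [x /= /fr ? <-].
Qed.

Lemma dual_norm_ge0 f : 0 <= dual_norm f.
Proof. by rewrite (le_trans _ (@dual_norm_ub f 0 _)) ?normr0. Qed.

Lemma dual_normD f g : dual_norm (f + g) <= dual_norm f + dual_norm g.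
Proof.
apply: dual_norm_le => x x1; rewrite (le_trans (ler_normD _ _))//.
by rewrite lerD// dual_norm_ub.
Qed.

Lemma dual_normZ (a : R) f : dual_norm (a *: f) = `|a| * dual_norm f.
Proof.
have le_normZ b g : dual_norm (b *: g) <= `|b| * dual_norm g.
  apply: dual_norm_le => x x1; rewrite [X in `|X|](_ : _ = b * g x)// normrM.
  by rewrite ler_wpM2l// dual_norm_ub.
apply/eqP; rewrite eq_le le_normZ /=.
have [->|a0] := eqVneq a 0; first by rewrite normr0 mul0r dual_norm_ge0.
rewrite -ler_pdivlMl ?normr_gt0// -normfV.
by rewrite (le_trans _ (le_normZ _ _))// scalerA mulVf// scale1r.
Qed.

Lemma dual_norm_eq0 f : dual_norm f = 0 -> f = 0.
Proof.
move=> f0; apply: dualP => x; have [->|x0] := eqVneq x 0; first exact: linear0.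
have : `|f (`|x|^-1 *: x)| <= 0.
  rewrite -f0; apply: dual_norm_ub.
  by rewrite normrZ normfV normr_id mulVf// normr_eq0.
rewrite normr_le0 linearZ /= scaler_eq0 invr_eq0 normr_eq0 (negbTE x0) /=.
by move=> /eqP.
Qed.

HB.instance Definition _ := Lmodule_isNormed.Build R dual
  dual_normD dual_normZ dual_norm_eq0.

Definition weakstar : Type :=
  initial_topology (dual_fun : dual -> {ptws V -> R^o}).
HB.instance Definition _ := Topological.on weakstar.

End Dual.

Definition weak {R : realType} (V : normedModType R) : Type :=
  initial_topology ((fun v f => f v) : V -> {ptws dual V -> R^o}).
HB.instance Definition _ (R : realType) (V : normedModType R) :=
  Topological.on (weak V).

Section WeakTopologies.
Context {R : realType} {V : normedModType R}.

Let cvg_initial_ptws (S : choiceType) (U : Type) (T : topologicalType)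
    (h : S -> {ptws U -> T}) (F : set_system S) (s : S) : Filter F ->
  F --> (s : initial_topology h) <-> forall x, (fun t => h t x) @ F --> h s x.
Proof.
move=> FF; split=> [Fs x|Fs].
  apply: (@cvg_trans _ ((fun g : U -> T => g x) @ (h @ F))) => //.
  have /cvg_sup/(_ x) hs : h @ F --> (h s : {ptws U -> T}).
    apply: cvg_trans; first exact: (cvg_app _ Fs).
    exact: initial_continuous.
  apply: cvg_trans; first exact: (cvg_app _ hs).
  exact: (@initial_continuous _ _ (fun g : U -> T => g x)).
move=> A; rewrite nbhsE /= => -[B [[D oD <-] Ds] DA].
rewrite nbhs_filterE; apply: filterS DA _.
suff : h @ F --> (h s : {ptws U -> T}) by apply; exact: open_nbhs_nbhs.
apply/cvg_sup => x E; rewrite nbhsE /= => -[G [[H oH <-] Hs] HE].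
by rewrite nbhs_filterE; apply: filterS HE _; apply: Fs; exact: open_nbhs_nbhs.
Qed.

Lemma cvg_weakstarP (F : set_system (dual V)) (f : dual V) : Filter F ->
  F --> (f : weakstar V) <-> forall x, (fun g : dual V => g x) @ F --> f x.
Proof. by move=> FF; exact: cvg_initial_ptws. Qed.

Lemma cvg_weakP (F : set_system V) (v : V) : Filter F ->
  F --> (v : weak V) <-> forall f : dual V, f @ F --> f v.
Proof. by move=> FF; exact: cvg_initial_ptws. Qed.

End WeakTopologies.

Definition separable (T : topologicalType) :=
  exists2 A : set T, countable A & dense A.

(* The Frechet derivative DF takes values in dual V, so that its own          *)
(* differentiability refers to the operator norm.                             *)
Definition twice_differentiable {R : realType} {V : normedModType R}
    (F : V -> R^o) :=
  exists DF : V -> dual V,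
    (forall x, is_diff x F (DF x)) /\ (forall x, differentiable DF x).

Definition extremal_points {R : realType} {E : lmodType R} (B : set E) : set E :=
  [set u | B u /\ forall (t : R) u1 u2, 0 < t < 1 -> B u1 -> B u2 ->
    u = t *: u1 + (1 - t) *: u2 -> u1 = u /\ u2 = u].

(* Convexity and homogeneity of extended-real-valued functionals use the      *)
(* convention 0 * +oo = 0 of \bar R.                                          *)
Definition convex_functional {R : realType} {E : lmodType R} (f : E -> \bar R) :=
  forall (t : R) u v, 0 <= t <= 1 ->
    (f (t *: u + (1 - t) *: v)%R <= t%:E * f u + (1 - t)%:E * f v)%E.

Definition pos_homogeneous {R : realType} {E : lmodType R} (f : E -> \bar R) :=
  forall (lambda : R) u, 0 <= lambda -> f (lambda *: u) = (lambda%:E * f u)%E.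

Section Functionals.
Context {R : realType} {C Y : normedModType R}.
Variables (K : dual C -> Y) (F : Y -> R^o) (Reg : dual C -> \bar R).

Definition Dom : set (dual C) := [set u | (Reg u < +oo)%E].

Definition J (u : dual C) : \bar R := ((F (K u))%:E + Reg u)%E.

Definition unit_sublevel : set (dual C) := [set u | (Reg u <= 1)%E].

Definition Btilde : set (dual C) :=
  closure (extremal_points unit_sublevel : set (weakstar C)).

Definition mean_field (n : nat) (c : 'I_n -> R) (u : 'I_n -> dual C) : dual C :=
  n%:R^-1 *: \sum_(j < n) (c j) ^+ 2 *: u j.

(* The index ranges over the positive integers; J_ 0 is a junk value, which   *)
(* liminf and limsup do not see.                                              *)
Definition J_ (n : nat) (v : dual C) : \bar R :=
  if `[< exists (c : 'I_n -> R) (u : 'I_n -> dual C),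
           [/\ forall j, 0 <= c j, forall j, Btilde (u j) & v = mean_field c u] >]
  then J v else +oo%E.

End Functionals.

(* Main.v *)
Require Import Defs.
From HB Require Import structures.
From mathcomp Require Import all_boot all_order all_algebra.
From mathcomp Require Import sesquilinear.
From mathcomp Require Import all_classical all_reals all_analysis.
From mathcomp Require Import ring lra.
Set Implicit Arguments.
Unset Strict Implicit.
Unset Printing Implicit Defensive.
Import Order.TTheory GRing.Theory Num.Theory.
Import numFieldNormedType.Exports.
Local Open Scope classical_set_scope.
Local Open Scope ring_scope.

(* The liminf inequality holds because J <= J_n and J is sequentially weak*
   lower semicontinuous. For the limsup inequality, B is a weak* compact convex
   set containing 0, so v / Reg v is, by Krein-Milman, a weak* limit of
   combinations sum_j a_j u_j of extremal points with a_j >= 0 and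
   sum_j a_j <= 1; separability of C makes the limit sequential, and the n-th
   combination may be given n terms by letting the approximation improve slowly
   enough. With c_j = sqrt (n a_j Reg v) the corresponding mean field v_n has
   Reg v_n <= Reg v, and K v_n converges strongly to K v. If Reg v = 0, then
   v = 0, because the ray through v lies in the compact set {Reg <= 0}. *)

(** * Dense sequences and weak* convergence *)

Lemma separable_dense_seq (T : ptopologicalType) : separable T ->
  exists x_ : nat -> T, dense (range x_).
Proof.
move=> [A cA dA].
have [a [_ Aa]] : [set: T] `&` A !=set0.
  by apply: dA; [exists point|exact: openT].
have /pcard_surjP[x_ xA] : (A #<= [set: nat])%card by [].
exists x_ => O O0 oO; have [y [Oy Ay]] := dA O O0 oO.
by exists y; split=> //; have [i _ <-] := xA y Ay; exists i.
Qed.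

Section WeakStar.
Context {R : realType} {V : normedModType R}.
Implicit Types (f g u v w : dual V) (A B : set (dual V)) (x y : V).

Lemma weakstar_eval_continuous x :
  continuous ((fun u : dual V => (u x : R)) : weakstar V -> R).
Proof.
move=> u; have /cvg_weakstarP : nbhs (u : weakstar V) --> (u : weakstar V).
  by [].
exact.
Qed.

Lemma dual_eq_dense (x_ : nat -> V) f g : dense (range x_) ->
  (forall i, f (x_ i) = g (x_ i)) -> f = g.
Proof.
move=> dx fg; apply: dualP => x; apply/eqP/negPn/negP => fgx.
pose h := (f : V -> R) \- (g : V -> R).
have ch : continuous h.
  by move=> y; apply: continuousB; exact: dual_continuous.
have oh : open (h @^-1` [set r : R | r != 0]).
  apply: open_comp; first by move=> y _; exact: ch.
  exact: open_neq.
have [|y [/= hy [i _ iy]]] := dx _ _ oh.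
  by exists x; rewrite /h /= subr_eq0.
by move: hy; rewrite /h -iy /= fg subrr eqxx.
Qed.

Lemma weakstar_hausdorff : hausdorff_space (weakstar V).
Proof.
move=> p q; rewrite cluster_cvgE => -[G PG [Gq pG]].
apply: dualP => x; apply: (@cvg_unique R^o _ (((fun u : dual V => u x) : _ -> R^o) @ G)).
- exact: Rhausdorff.
- exact: cvg_trans (cvg_app _ pG) (@weakstar_eval_continuous x p).
- exact: cvg_trans (cvg_app _ Gq) (@weakstar_eval_continuous x q).
Qed.

(** Takes the place of metrizability of weak* compact sets. If [w_] left a neighbourhood of [w]
    infinitely often, compactness would give a cluster point along those indices; it agrees with [w]
    on a dense set, so it is [w], a contradiction. *)
Lemma compact_weakstar_cvg (x_ : nat -> V) B (w_ : nat -> dual V) w :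
  dense (range x_) -> compact (B : set (weakstar V)) ->
  (forall n, B (w_ n)) ->
  (forall i, (fun n => w_ n (x_ i) : R) @ \oo --> (w (x_ i) : R)) ->
  (w_ : nat -> weakstar V) @ \oo --> (w : weakstar V).
Proof.
move=> dx cB wB wx U Uw; apply: contrapT => nU.
pose G := within (~` ((w_ : nat -> weakstar V) @^-1` U)) \oo.
have PG : ProperFilter G.
  apply: Build_ProperFilter_ex => A /= GA; apply: contrapT => A0; apply: nU.
  move: GA; rewrite /G /within /nbhs /=; apply: filterS => n nAU.
  by apply: contrapT => /nAU ?; apply: A0; exists n.
have GB : ((w_ : nat -> weakstar V) @ G) B.
  by apply: filterS (filterT : G setT) => n _ /=; exact: wB.
have [p [Bp]] := cB _ _ GB; rewrite cluster_cvgE => -[H PH [Hp GH]].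
have pw : p = w.
  apply: (dual_eq_dense dx) => i.
  apply: (@cvg_unique R^o _ (((fun u : dual V => u (x_ i)) : _ -> R^o) @ H)).
  - exact: Rhausdorff.
  - exact: cvg_trans (cvg_app _ Hp) (@weakstar_eval_continuous (x_ i) p).
  - move=> N Nw; apply: GH.
    have := wx i N Nw; rewrite /nbhs /= => wN.
    by rewrite /G /within /=; move: wN; apply: filterS => n /= ? _.
have HU : H U by apply: Hp; rewrite pw.
have HnU : H (~` U).
  by apply: GH; rewrite /G /within /=; exact: nearW.
by have /filter_ex[u []] : H (U `&` ~` U) by exact: filterI.
Qed.

End WeakStar.

(** * Lexicographic minimisation and existence of extremal points *)

Section MinimalFaces.
Context {R : realType} {V : normedModType R}.
Implicit Types (f g u v w : dual V) (A B : set (dual V)) (x y : V).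

Definition argmin x B : set (dual V) :=
  [set u | B u /\ forall v, B v -> u x <= v x].

Fixpoint lex_argmin (x_ : nat -> V) B n : set (dual V) :=
  if n is m.+1 then argmin (x_ m) (lex_argmin x_ B m) else B.

Lemma argmin_compact x B : B !=set0 -> compact (B : set (weakstar V)) ->
  argmin x B !=set0 /\ compact (argmin x B : set (weakstar V)).
Proof.
move=> B0 cB.
have cx : {within (B : set (weakstar V)),
    continuous ((fun u : dual V => u x) : weakstar V -> R)}.
  exact: (continuous_subspaceT (@weakstar_eval_continuous _ _ x)).
have [c /set_mem Bc cmin] :=
  @compact_EVT_min (weakstar V) R (fun u : dual V => u x) _ B0 cB cx.
have cmin' v : B v -> c x <= v x by move=> Bv; apply: cmin; exact: mem_set.
split; first by exists c.
have -> : argmin x B = (B : set (weakstar V)) `&`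
    ((fun u : dual V => u x : R) @^-1` [set r | r <= c x]).
  apply/seteqP; split=> [u [Bu umin]|u [Bu /= uc]]; split=> //=; first exact: umin.
  by move=> v Bv; exact: le_trans uc (cmin' v Bv).
apply: compact_closedI => //; apply: closed_comp; last exact: closed_le.
by move=> u _; exact: weakstar_eval_continuous.
Qed.

Lemma lex_argmin_compact (x_ : nat -> V) B n : B !=set0 ->
  compact (B : set (weakstar V)) ->
  lex_argmin x_ B n !=set0 /\ compact (lex_argmin x_ B n : set (weakstar V)).
Proof. by move=> B0 cB; elim: n => //= n [ne cn]; exact: argmin_compact. Qed.

Lemma lex_argmin_decr (x_ : nat -> V) B m n : (m <= n)%N ->
  lex_argmin x_ B n `<=` lex_argmin x_ B m.
Proof.
move=> /subnK <-; elim: (n - m)%N => // k IH u; rewrite addSn => -[+ _].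
exact: IH.
Qed.

(** Evaluation at a point is affine, so when an interior point of a segment minimises it, both ends
    take the same minimal value; induct over the stages. *)
Lemma lex_argmin_face (x_ : nat -> V) B n (t : R) u1 u2 : 0 < t < 1 ->
  B u1 -> B u2 -> lex_argmin x_ B n (t *: u1 + (1 - t) *: u2) ->
  [/\ lex_argmin x_ B n u1, lex_argmin x_ B n u2 &
      forall i, (i < n)%N -> u1 (x_ i) = u2 (x_ i)].
Proof.
move=> /andP[t0 t1] Bu1 Bu2; elim: n => //= n IH [/IH[F1 F2 eq12] umin].
have e x : (t *: u1 + (1 - t) *: u2) x = t * u1 x + (1 - t) * u2 x by [].
have := umin _ F1; have := umin _ F2; rewrite e => h2 h1.
have e12 : u1 (x_ n) = u2 (x_ n) by apply/eqP; rewrite eq_le; apply/andP; split; nra.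
have e1 : (t *: u1 + (1 - t) *: u2) (x_ n) = u1 (x_ n).
  by rewrite e -e12 -mulrDl addrC subrK mul1r.
split=> [||i].
- by split=> // v /umin; rewrite e1.
- by split=> // v /umin; rewrite e1 e12.
- by rewrite ltnS leq_eqVlt => /predU1P[->//|]; exact: eq12.
Qed.

(* Minimise x first, then the terms of a dense sequence one after the other:  *)
(* these nested faces of B shrink to a single point.                          *)
Lemma extremal_point_minimizer B x : separable V -> B !=set0 ->
  compact (B : set (weakstar V)) ->
  exists2 e, extremal_points B e & forall u, B u -> e x <= u x.
Proof.
move=> /separable_dense_seq[x_ dx] B0 cB.
pose y_ n := if n is m.+1 then x_ m else x.
have /choice[e_ eP] n := (lex_argmin_compact y_ n B0 cB).1.
have B_e : ((e_ : nat -> weakstar V) @ \oo) B.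
  by exists 0%N => // n _; exact: (lex_argmin_decr (leq0n n) (eP n)).
(* The faces are closed and decreasing, and [e_ k] lies in the [n]-th one for all [k >= n], so a
   cluster point lies in all of them. *)
have [e [Be ce]] := cB _ _ B_e.
have Fe n : lex_argmin y_ B n e.
  have cl : closed (lex_argmin y_ B n : set (weakstar V)).
    exact: (compact_closed weakstar_hausdorff (lex_argmin_compact y_ n B0 cB).2).
  rewrite ((closure_id _).1 cl); move: ce; rewrite clusterE; apply.
  by apply: filterS (nbhs_infty_ge n) => k nk; exact: (lex_argmin_decr nk (eP k)).
exists e; last by move=> u Bu; have [_] := Fe 1%N; exact.
split=> // t u1 u2 t01 Bu1 Bu2 eE.
have u12 : u1 = u2.
  apply: (dual_eq_dense dx) => i.
  (* [x_ i] is [y_ i.+1], which is minimised in passing to stage [i.+2]. *)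
  have := Fe i.+2; rewrite [in X in X -> _]eE.
  by move=> /(lex_argmin_face t01 Bu1 Bu2)[_ _ /(_ i.+1 (ltnSn _))].
have e1 : e = u1 by rewrite eE -u12 -scalerDl addrC subrK scale1r.
by rewrite -u12 e1.
Qed.

End MinimalFaces.

(** * Combinations with total weight at most one *)

Definition subconvex {R : realType} {E : lmodType R} (B : set E) :=
  B 0 /\ forall (p q : R) u v, 0 <= p -> 0 <= q -> p + q <= 1 ->
    B u -> B v -> B (p *: u + q *: v).

Section SubconvexCombinations.
Context {R : realType} {E : lmodType R}.
Implicit Types (A B : set E) (p q r : R) (u v w : E).

(** Total weight at most 1, instead of exactly 1, lets 0 be a combination of any length, so that
    shorter combinations can be padded with zero weights. *)
Definition subconvex_comb A n : set E := [set w |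
  exists (a : 'I_n -> R) (u : 'I_n -> E),
    [/\ forall j, 0 <= a j, \sum_(j < n) a j <= 1, forall j, A (u j) &
        w = \sum_(j < n) a j *: u j]].

Lemma subconvex_comb0 A n : A !=set0 -> subconvex_comb A n 0.
Proof.
move=> [e Ae]; exists (fun=> 0), (fun=> e); split=> //.
- by rewrite big1.
- by rewrite big1// => j _; rewrite scale0r.
Qed.

Lemma subconvex_combD A m n p q u v : 0 <= p -> 0 <= q -> p + q <= 1 ->
  subconvex_comb A m u -> subconvex_comb A n v ->
  subconvex_comb A (m + n) (p *: u + q *: v).
Proof.
move=> p0 q0 pq1 [a [x [a0 a1 Ax ->]]] [b [y [b0 b1 By ->]]].
exists (fun j => match fintype.split j with inl i => p * a i | inr i => q * b i end).
exists (fun j => match fintype.split j with inl i => x i | inr i => y i end).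
have splitl i : fintype.split (lshift n i) = inl i :> 'I_m + 'I_n.
  exact: (unsplitK (inl i)).
have splitr i : fintype.split (rshift m i) = inr i :> 'I_m + 'I_n.
  exact: (unsplitK (inr i)).
split.
- by move=> j; case: (fintype.split _) => i; rewrite mulr_ge0.
- rewrite big_split_ord /=; under eq_bigr do rewrite splitl.
  under [X in _ + X]eq_bigr do rewrite splitr.
  by rewrite -!mulr_sumr; nra.
- by move=> j; case: (fintype.split _).
- rewrite big_split_ord /=; under [X in _ = X + _]eq_bigr do rewrite splitl.
  under [X in _ = _ + X]eq_bigr do rewrite splitr.
  by rewrite !scaler_sumr; congr (_ + _); apply: eq_bigr => i _; rewrite scalerA.
Qed.

Lemma subconvex_comb_le A m n u : A !=set0 -> (m <= n)%N ->
  subconvex_comb A m u -> subconvex_comb A n u.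
Proof.
move=> A0 mn Au.
have := subconvex_combD ler01 (lexx 0) _ Au (subconvex_comb0 (n - m) A0).
by rewrite subnKC// scale1r scaler0 !addr0; exact.
Qed.

Lemma subconvex_comb_sub A B n : subconvex B -> A `<=` B ->
  subconvex_comb A n `<=` B.
Proof.
move=> [B0 BD] AB _ [a [u [a0 a1 /(_ _)/AB Bu ->]]].
(* The bound 1 is generalised to any [r] above the total weight, because the induction removes the
   last weight and leaves a smaller total. *)
suff [b Bb ->] : exists2 b, B b & \sum_(j < n) a j *: u j = 1 *: b by rewrite scale1r.
move: 1 a1; elim: n a u a0 Bu => [|n IH] a u a0 Bu r.
  by rewrite !big_ord0 => _; exists 0; rewrite ?scaler0.
rewrite !big_ord_recr /= => ar.
set s := \sum_(i < n) a (widen_ord _ i) in ar.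
have s0 : 0 <= s by rewrite sumr_ge0.
have [b Bb ->] := IH _ (fun i => u (widen_ord (leqnSn n) i))
  (fun i => a0 _) (fun i => Bu _) s (lexx s).
have [r0|r0] := eqVneq r 0.
  have an0 : a ord_max = 0 by have := a0 ord_max; lra.
  have -> : s = 0 by have := a0 ord_max; lra.
  by exists 0 => //; rewrite an0 !scale0r addr0 scaler0.
have rp : 0 < r by have := a0 ord_max; lra.
exists ((s / r) *: b + (a ord_max / r) *: u ord_max).
  apply: BD => //; rewrite ?divr_ge0// ?(ltW rp)//.
  by rewrite -mulrDl ler_pdivrMr// mul1r.
by rewrite scalerDr !scalerA !(mulrC r) !divfK.
Qed.

End SubconvexCombinations.

(** * Separation by finitely many evaluations *)

Section Separation.
Context {R : realType} {V : normedModType R}.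
Implicit Types (u v w : dual V) (A : set (dual V)).

(* Expanding the square along the segment from an almost minimiser a0 of the  *)
(* distance to w shows that y := \sum_i (a0 (x i) - w (x i)) *: x i separates *)
(* w from A; boundedness makes the choice of a0 uniform over A.               *)
Lemma finite_separation A w k (x : 'I_k -> V) (e M : R) : A !=set0 -> 0 < e ->
  (forall (t : R) u v, 0 <= t <= 1 -> A u -> A v -> A (t *: u + (1 - t) *: v)) ->
  (forall u, A u -> e <= \sum_(i < k) (u (x i) - w (x i)) ^+ 2 <= M) ->
  exists y, forall u, A u -> w y < u y.
Proof.
move=> A0 e0 Aconv AM; pose S u := \sum_(i < k) (u (x i) - w (x i)) ^+ 2.
have M0 : 0 < M by case: A0 => a /AM/andP[h1 h2]; lra.
have iS : has_inf (S @` A).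
  split; first by case: A0 => a Aa; exists (S a), a.
  by exists e => _ [a Aa <-]; case/andP: (AM _ Aa).
pose D := inf (S @` A).
have De : e <= D.
  by apply: lb_le_inf; [exact: iS.1|move=> _ [a Aa <-]; case/andP: (AM _ Aa)].
have DS u : A u -> D <= S u by move=> Au; apply: ge_inf; [exact: iS.2|exists u].
(* The expansion below gives [2 * P > - t * (1 + 4 * M)]. This [t] makes the right-hand side
   [t * D - D], hence [P > - D / 2], while [S a0 >= D]. *)
pose t := D / (D + 1 + 4 * M).
have d0 : 0 < D + 1 + 4 * M by lra.
have t0 : 0 < t by rewrite divr_gt0//; lra.
have tE : t * (D + 1 + 4 * M) = D by rewrite divfK// gt_eqF.
have t1 : t <= 1 by rewrite ler_pdivrMr//; lra.
have t20 : 0 < t ^+ 2 by rewrite exprn_gt0.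
have [_ [a0 Aa0 <-] Sa0] := inf_adherent t20 iS.
exists (\sum_(i < k) (a0 (x i) - w (x i)) *: x i) => u Au.
pose P := \sum_(i < k) (u (x i) - a0 (x i)) * (a0 (x i) - w (x i)).
pose Q := \sum_(i < k) (u (x i) - a0 (x i)) ^+ 2.
(* Parallelogram identity: [2 * S u + 2 * S a0] exceeds [Q] by a sum of squares. *)
have QM : Q <= 4 * M.
  apply: (@le_trans _ _ (2 * S u + 2 * S a0)).
    rewrite /Q /S !mulr_sumr -big_split /=; apply: ler_sum => i _.
    have := sqr_ge0 (u (x i) + a0 (x i) - 2 * w (x i)); nra.
  by have /andP[_ h1] := AM _ Au; have /andP[_ h2] := AM _ Aa0; rewrite /S; lra.
have expand : S (t *: u + (1 - t) *: a0) = S a0 + 2 * t * P + t ^+ 2 * Q.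
  rewrite /S /P /Q !mulr_sumr -!big_split /=; apply: eq_bigr => i _.
  rewrite [X in (X - _) ^+ 2 = _](_ : _ = t * u (x i) + (1 - t) * a0 (x i))//.
  ring.
have := DS _ (Aconv t u a0 _ Au Aa0); rewrite expand t1 (ltW t0) => /(_ isT) h.
(* [P + S a0] is the difference of the values of [u] and [w] at the separating point. *)
have PS : 0 < P + S a0.
  have h1 : 0 < 2 * t * P + t ^+ 2 + t ^+ 2 * (4 * M) by have := ltW t20; nra.
  have h2 : 0 < 2 * P + t + t * (4 * M).
    rewrite -(pmulr_rgt0 _ t0).
    have -> // : t * (2 * P + t + t * (4 * M)) =
                 2 * t * P + t ^+ 2 + t ^+ 2 * (4 * M) by ring.
  by have := DS _ Aa0; nra.
have evalE (f : dual V) : f (\sum_(i < k) (a0 (x i) - w (x i)) *: x i) =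
    \sum_(i < k) (a0 (x i) - w (x i)) * f (x i).
  by rewrite linear_sum; apply: eq_bigr => i _; rewrite linearZ.
rewrite !evalE -subr_gt0 -sumrB (lt_le_trans PS)// /P /S -big_split /=.
by apply: ler_sum => i _; rewrite le_eqVlt; apply/orP; left; apply/eqP; ring.
Qed.

End Separation.

(** * Sequential Krein-Milman theorem *)

Section KreinMilman.
Context {R : realType} {V : normedModType R}.
Implicit Types (u v w : dual V) (B : set (dual V)) (x : V).

Lemma compact_eval_bounded B x : compact (B : set (weakstar V)) ->
  exists c : R, forall u, B u -> `|u x| <= c.
Proof.
move=> cB; have [[u Bu]|B0] := pselect (B !=set0); last first.
  by exists 0 => u Bu; exfalso; apply: B0; exists u.
have cx : {within (B : set (weakstar V)),
    continuous ((fun u : dual V => `|u x| : R) : weakstar V -> R)}.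
  apply: continuous_subspaceT => v.
  exact: (@cvg_norm _ R^o _ _ _ _ _ (@weakstar_eval_continuous _ _ x v)).
have [c _ cmax] := @compact_EVT_max (weakstar V) R _ _ (ex_intro _ u Bu) cB cx.
by exists `|(c : dual V) x| => v Bv; apply: cmax; exact: mem_set.
Qed.

(* Otherwise some y separates w from the combinations of extremal points,     *)
(* although an extremal point e minimising the evaluation at y over B has     *)
(* e y <= w y.                                                                *)
Lemma subconvex_comb_approx B w k (x : 'I_k -> V) (e : R) : separable V ->
  compact (B : set (weakstar V)) -> subconvex B -> B w -> 0 < e ->
  exists n u, subconvex_comb (extremal_points B) n u /\
              \sum_(i < k) (u (x i) - w (x i)) ^+ 2 < e.
Proof.
move=> sV cB sB Bw e0; apply: contrapT => noapprox.
have B0 : B !=set0 by exists w.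
have ExtB : extremal_points B `<=` B by move=> ? [].
(* Taking all lengths together makes [A] convex: combining two elements concatenates their terms. *)
pose A : set (dual V) := \bigcup_n subconvex_comb (extremal_points B) n.
have AB : A `<=` B by move=> u [n _]; exact: subconvex_comb_sub.
have Ext0 : extremal_points B !=set0.
  by have [e1 Ee1 _] := extremal_point_minimizer 0 sV B0 cB; exists e1.
have /choice[c cP] i := compact_eval_bounded (x i) cB.
have [|||y wy] := @finite_separation _ _ A w _ x e
    (\sum_(i < k) (2 * c i) ^+ 2) _ e0.
- by exists 0, 0%N => //; exact: subconvex_comb0.
- move=> t u v /andP[t0 t1] [m _ Au] [n _ Av]; exists (m + n)%N => //.
  by apply: subconvex_combD => //; [rewrite subr_ge0|rewrite addrC subrK].
- move=> u [n An Au]; apply/andP; split.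
    by rewrite leNgt; apply/negP => Su; apply: noapprox; exists n, u.
  apply: ler_sum => i _; have := cP i _ Bw; have := cP i u (AB u _).
  rewrite !ler_norml => /(_ (ex_intro2 _ _ n An Au)) /andP[h1 h2] /andP[h3 h4].
  nra.
have [f Ef fmin] := extremal_point_minimizer y sV B0 cB.
have Af : A f.
  exists 1%N => //; exists (fun=> 1), (fun=> f); split=> //.
  - by rewrite big_ord1.
  - by rewrite big_ord1 scale1r.
by have := wy f Af; rewrite ltNge fmin.
Qed.

(* A sequential form of the Krein-Milman theorem in which the n-th term has   *)
(* at most n summands: it is as close to w as n summands allow.               *)
Lemma krein_milman_sequence B w : separable V ->
  compact (B : set (weakstar V)) -> subconvex B -> B w ->
  exists w_ : nat -> dual V,
    (forall n, subconvex_comb (extremal_points B) n (w_ n)) /\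
    (w_ : nat -> weakstar V) @ \oo --> (w : weakstar V).
Proof.
move=> sV cB sB Bw; have [x_ dx] := separable_dense_seq sV.
have Ext0 : extremal_points B !=set0.
  have B0 : B !=set0 by exists w.
  by have [e Ee _] := extremal_point_minimizer 0 sV B0 cB; exists e.
(* One index controls both the number of test points and the tolerance, so closeness gets stricter
   with [k]; [close 0] holds trivially, by the empty sum. *)
pose close k u := \sum_(i < k) (u (x_ i) - w (x_ i)) ^+ 2 < k.+1%:R^-1.
have closeW k m u : (k <= m)%N -> close m u -> close k u.
  move=> km; rewrite /close => cm.
  have : m.+1%:R^-1 <= k.+1%:R^-1 :> R by rewrite lef_pV2 ?posrE// ler_nat.
  apply: lt_le_trans; apply: le_lt_trans cm.
  rewrite -(big_mkord xpredT (fun i => (u (x_ i) - w (x_ i)) ^+ 2)).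
  rewrite -(big_mkord xpredT (fun i => (u (x_ i) - w (x_ i)) ^+ 2)).
  rewrite (big_cat_nat (leq0n k) km) /= lerDl.
  by apply: sumr_ge0 => i _; exact: sqr_ge0.
pose P n := subconvex_comb (extremal_points B) n.
(* The cutoff [m] is there because a single [w_ n] need not attain every attainable level if there
   are infinitely many; it is then taken equal to [n]. *)
have best n m : exists2 u, P n u & forall k, (k <= m)%N ->
    (exists2 v, P n v & close k v) -> close k u.
  elim: m => [|m [u Pu IH]].
    exists 0; first exact: subconvex_comb0.
    by move=> k; rewrite leqn0 => /eqP-> _; rewrite /close big_ord0 invr_gt0.
  have [[v Pv cv]|nv] := pselect (exists2 v, P n v & close m.+1 v).
    by exists v => // k km _; exact: closeW km cv.
  exists u => // k; rewrite leq_eqVlt => /predU1P[->//|]; rewrite ltnS.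
  exact: IH.
have /choice[w_ wP] n : exists u, P n u /\ forall k, (k <= n)%N ->
    (exists2 v, P n v & close k v) -> close k u.
  by have [u] := best n n; exists u.
have Pw n : P n (w_ n) := (wP n).1.
exists w_; split=> //; apply: (compact_weakstar_cvg dx cB).
  by move=> n; apply: subconvex_comb_sub (Pw n) => // ? [].
move=> i; apply/(@cvgrPdist_lt R R^o) => e e0.
have e20 : 0 < e ^+ 2 by rewrite exprn_gt0.
(* Level [k] tests [x_ i] with squared error below [e ^+ 2]. It is attained with some [N] terms,
   hence by [w_ n] once [n] exceeds both [k] and [N]. *)
have [k [ke ik]] : exists k, k.+1%:R^-1 < e ^+ 2 /\ (i < k)%N.
  near \oo => k; exists k; split; near: k; last exact: nbhs_infty_gt.
  exact: (near_infty_natSinv_lt (PosNum e20)).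
have k0 : 0 < k.+1%:R^-1 :> R by rewrite invr_gt0.
have [N [u [Pu cu]]] :=
  subconvex_comb_approx (fun j : 'I_k => x_ j) sV cB sB Bw k0.
near=> n.
have : close k (w_ n).
  apply: (wP n).2; first by near: n; exact: nbhs_infty_ge.
  exists u => //; apply: subconvex_comb_le Pu => //.
  by near: n; exact: nbhs_infty_ge.
rewrite /close (bigD1 (Ordinal ik)) //= => /lt_trans/(_ ke).
set s := \sum_(_ < _ | _) _ => h.
have s0 : 0 <= s by apply: sumr_ge0 => j _; exact: sqr_ge0.
rewrite -(@ltr_pXn2r _ 2)// ?nnegrE// ?(ltW e0)// real_normK ?num_real//.
by rewrite -sqrrN opprB; lra.
Unshelve. all: by end_near. Qed.

End KreinMilman.

(** * Sublevel sets of the regularizer *)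

Section Sublevel.
Context {R : realType} {V : normedModType R} (Reg : dual V -> \bar R).
Hypothesis Reg_hom : pos_homogeneous Reg.

Lemma pos_homogeneous_at0 : Reg 0 = 0%E.
Proof. by rewrite -[0 in LHS](scale0r 0) Reg_hom// mul0e. Qed.

Lemma unit_sublevel_subconvex : convex_functional Reg ->
  subconvex (unit_sublevel Reg).
Proof.
move=> Reg_convex; split; first by rewrite /unit_sublevel /= pos_homogeneous_at0.
move=> p q u v p0 q0 pq1 Bu Bv.
have [pq0|pq0] := eqVneq (p + q) 0.
  have -> : p = 0 by lra.
  have -> : q = 0 by lra.
  by rewrite !scale0r addr0 /unit_sublevel /= pos_homogeneous_at0.
have pq : 0 < p + q by rewrite lt_neqAle eq_sym pq0 addr_ge0.
have t01 : 0 <= p / (p + q) <= 1.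
  by rewrite divr_ge0 ?(ltW pq)//= ler_pdivrMr// mul1r lerDl.
have qE : 1 - p / (p + q) = q / (p + q).
  by rewrite -{1}(divff pq0) -mulrBl addrAC subrr add0r.
have -> : p *: u + q *: v =
    (p + q) *: ((p / (p + q)) *: u + (1 - p / (p + q)) *: v).
  by rewrite qE scalerDr !scalerA !(mulrC (p + q)) !divfK.
rewrite /unit_sublevel /= Reg_hom ?(ltW pq)//.
apply: (@le_trans _ _ ((p + q)%:E * 1)%E); last by rewrite mule1 lee_fin.
apply: lee_wpmul2l; first by rewrite lee_fin ltW.
apply: (le_trans (Reg_convex _ u v t01)).
case/andP: t01 => t0 t1.
rewrite (_ : 1%E = ((p / (p + q))%:E * 1 + (1 - p / (p + q))%:E * 1)%E).
  by apply: leeD; apply: lee_wpmul2l => //; rewrite lee_fin// subr_ge0.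
by rewrite !mule1 -EFinD addrC subrK.
Qed.

Lemma compact_kernel_trivial v :
  compact ([set u | (Reg u <= 0%:E)%E] : set (weakstar V)) ->
  Reg v = 0%E -> v = 0.
Proof.
move=> cker Rv0; apply: dualP => x.
have [c cP] := compact_eval_bounded x cker.
have lv (l : R) : 0 <= l -> l * `|v x| <= c.
  move=> l0; have /cP : (Reg (l *: v) <= 0%:E)%E by rewrite Reg_hom// Rv0 mule0.
  by rewrite [X in `|X|](_ : _ = l * v x)// normrM (ger0_norm l0).
apply/eqP; rewrite -normr_le0 leNgt; apply/negP => vx.
have c0 : 0 <= c by have := lv 0 (lexx 0); rewrite mul0r.
(* This multiple of [v] would have an evaluation of size [c + 1], above the bound [c]. *)
have := lv ((c + 1) / `|v x|); rewrite divfK ?gt_eqF//.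
have h : 0 <= (c + 1) / `|v x| by rewrite divr_ge0//; lra.
by move=> /(_ h); lra.
Qed.

End Sublevel.

(** * Comparison of upper and lower limits *)

Lemma le_limn_esup (R : realType) (u v : (\bar R)^nat) :
  (forall n, (u n <= v n)%E) -> (limn_esup u <= limn_esup v)%E.
Proof.
move=> uv; rewrite !limn_esup_lim; apply: lee_lim; try exact: is_cvg_esups.
apply: nearW => n; apply: ge_ereal_sup => _ [m nm <-].
by apply: (le_trans (uv m)); apply: ereal_sup_ubound; exists m.
Qed.

Lemma near_le_limn_einf (R : realType) (u : (\bar R)^nat) (l : \bar R) :
  (\forall n \near \oo, (l <= u n)%E) -> (l <= limn_einf u)%E.
Proof.
move=> [N _ lu]; rewrite limn_einf_lim; apply: lime_ge.
  exact: is_cvg_einfs.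
exists N => // n /= Nn; apply: le_ereal_inf_tmp => _ [m /= nm <-].
by apply: lu; exact: leq_trans nm.
Qed.

(** * The two Gamma-convergence inequalities *)

Section GammaConvergence.
Context {R : realType} {C Y : normedModType R}.
Variables (K : dual C -> Y) (F : Y -> R^o) (Reg : dual C -> \bar R).
Hypothesis Reg_ge0 : forall u, (0 <= Reg u)%E.
Hypothesis F_continuous : continuous F.
Hypothesis K_strong : forall (u_ : nat -> dual C) (u : dual C),
  (forall n, Dom Reg (u_ n)) -> Dom Reg u ->
  (u_ : nat -> weakstar C) @ \oo --> (u : weakstar C) ->
  (fun n => K (u_ n)) @ \oo --> K u.

Lemma J_ge n v : (J K F Reg v <= J_ K F Reg n v)%E.
Proof. by rewrite /J_; case: ifPn => // _; rewrite leey. Qed.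

Lemma Gamma_liminf (v_ : nat -> dual C) v :
  lower_semicontinuous (Reg : weakstar C -> \bar R) ->
  (forall n, Dom Reg (v_ n)) -> Dom Reg v ->
  (v_ : nat -> weakstar C) @ \oo --> (v : weakstar C) ->
  (J K F Reg v <= limn_einf (fun n => J_ K F Reg n (v_ n)))%E.
Proof.
move=> Reg_lsc Dv_ Dv v_v; apply/lee_subgt0Pr => e e0.
(* Half of [e] pays for the semicontinuity of [Reg], half for the convergence of [F (K (v_ n))]. *)
have e20 : 0 < e / 2 by rewrite divr_gt0.
have FKv : (fun n => F (K (v_ n))) @ \oo --> (F (K v) : R^o).
  exact: (cvg_comp _ _ (K_strong Dv_ Dv v_v) (@F_continuous (K v))).
have Rfin : Reg v \is a fin_num by rewrite ge0_fin_numE.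
have [U Uv RU] : exists2 U, nbhs (v : weakstar C) U &
    forall y, U y -> ((fine (Reg v) - e / 2)%:E < Reg y)%E.
  apply: (Reg_lsc v); rewrite -{2}(fineK Rfin) lte_fin; lra.
apply: near_le_limn_einf; near=> n.
apply: le_trans (J_ge n (v_ n)); rewrite /J -(fineK Rfin).
have h1 : ((fine (Reg v) - e / 2)%:E <= Reg (v_ n))%E.
  by apply/ltW/RU; near: n; exact: v_v.
have h2 : F (K v) - e / 2 <= F (K (v_ n)).
  have : `|F (K v) - F (K (v_ n))| <= e / 2.
    by near: n; move/(@cvgrPdist_le R R^o): FKv; apply.
  by rewrite ler_norml => /andP[_]; lra.
have -> : ((F (K v))%:E + (fine (Reg v))%:E - e%:E =
    (F (K v) - e / 2)%:E + (fine (Reg v) - e / 2)%:E)%E.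
  by rewrite -EFinN -!EFinD; congr EFin; lra.
by rewrite leeD// lee_fin.
Unshelve. all: by end_near. Qed.

Lemma mean_field_sqrt n (r : R) (a : 'I_n -> R) (u : 'I_n -> dual C) :
  0 <= r -> (forall j, 0 <= a j) ->
  r *: \sum_(j < n) a j *: u j =
    mean_field (fun j => Num.sqrt (n%:R * (r * a j))) u.
Proof.
move=> r0 a0; rewrite /mean_field; case: n => [|n] in a u a0 *.
  by rewrite !big_ord0 !scaler0.
rewrite !scaler_sumr; apply: eq_bigr => j _.
rewrite sqr_sqrtr ?mulr_ge0// !scalerA; congr (_ *: _).
by rewrite !mulrA mulVf ?mul1r// pnatr_eq0.
Qed.

Lemma Gamma_limsup v : separable C -> convex_functional Reg ->
  pos_homogeneous Reg ->
  (forall alpha : R, 0 <= alpha ->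
    compact ([set u | (Reg u <= alpha%:E)%E] : set (weakstar C))) ->
  Dom Reg v ->
  exists v_ : nat -> dual C,
    [/\ forall n, Dom Reg (v_ n),
        (v_ : nat -> weakstar C) @ \oo --> (v : weakstar C),
        (limn_esup (fun n => J_ K F Reg n (v_ n)) <= J K F Reg v)%E
      & forall n,
          exists (c : 'I_n -> R) (u : 'I_n -> dual C),
            [/\ forall j, 0 <= c j <= Num.sqrt (n%:R * fine (Reg v)),
                forall j, Btilde Reg (u j),
                v_ n = mean_field c u
              & ((n%:R^-1 * \sum_(j < n) (c j) ^+ 2)%:E <= Reg v)%E]].
Proof.
move=> sC Reg_convex Reg_hom Reg_compact Dv.
have Rfin : Reg v \is a fin_num by rewrite ge0_fin_numE.
pose r := fine (Reg v); have RE : Reg v = r%:E by rewrite fineK.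
have r0 : 0 <= r by exact: fine_ge0.
have cB : compact (unit_sublevel Reg : set (weakstar C)) by exact: Reg_compact.
have sB := unit_sublevel_subconvex Reg_hom Reg_convex.
have [w Bw vw] : exists2 w, unit_sublevel Reg w & v = r *: w.
  have [r00|rn0] := eqVneq r 0.
    exists 0; first exact: sB.1.
    rewrite scaler0; apply: (compact_kernel_trivial Reg_hom (Reg_compact 0 _)) => //.
    by rewrite RE r00.
  exists (r^-1 *: v); last by rewrite scalerA divff// scale1r.
  by rewrite /unit_sublevel /= Reg_hom ?invr_ge0// RE -EFinM mulVf.
have [w_ [wE w_w]] := krein_milman_sequence sC cB sB Bw.
have Bw_ n : unit_sublevel Reg (w_ n).
  by apply: subconvex_comb_sub (wE n) => // ? [].
have Rv_ n : (Reg (r *: w_ n) <= r%:E)%E.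
  rewrite Reg_hom// -[leRHS]mule1; apply: lee_wpmul2l; last exact: Bw_.
  by rewrite lee_fin.
have Dv_ n : Dom Reg (r *: w_ n) by rewrite /Dom /= (le_lt_trans (Rv_ n))// ltry.
have v_v : ((fun n => r *: w_ n) : nat -> weakstar C) @ \oo --> (v : weakstar C).
  apply/cvg_weakstarP => x; rewrite vw.
  have /cvg_weakstarP/(_ x) wx := w_w.
  exact: (@cvgM R _ _ _ (cst r) _ r _ (cvg_cst r) wx).
have vE n : exists (c : 'I_n -> R) (u : 'I_n -> dual C),
    [/\ forall j, 0 <= c j <= Num.sqrt (n%:R * fine (Reg v)),
        forall j, Btilde Reg (u j),
        r *: w_ n = mean_field c u
      & ((n%:R^-1 * \sum_(j < n) (c j) ^+ 2)%:E <= Reg v)%E].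
  have [a [u [a0 a1 Eu ->]]] := wE n.
  exists (fun j => Num.sqrt (n%:R * (r * a j))), u; split.
  (* Each weight is at most the total weight, hence at most 1. *)
  - move=> j; rewrite sqrtr_ge0/= ler_wsqrtr// ler_wpM2l// -/r ler_piMr//.
    by apply: le_trans a1; rewrite (bigD1 j)//= lerDl sumr_ge0.
  - by move=> j; apply: subset_closure; exact: Eu.
  - exact: mean_field_sqrt.
  - rewrite RE lee_fin; under eq_bigr do rewrite sqr_sqrtr ?mulr_ge0//.
    (* The mean is [r] times the total weight; for [n = 0] it is 0, as the inverse of 0 is 0. *)
    rewrite -!mulr_sumr; case: n => [|n] in a u a0 a1 Eu *.
      by rewrite invr0 mul0r.
    by rewrite mulKf ?pnatr_eq0// ler_piMr.
exists (fun n => r *: w_ n); split=> //.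
(* [Reg (r *: w_ n)] is only known to be at most [r]; replacing it by [r] gives a convergent
   majorant whose limit is [J v]. *)
have FKv : (fun n => (F (K (r *: w_ n)) + r)%:E) @ \oo --> J K F Reg v.
  rewrite /J RE -EFinD; apply: cvg_EFin; first exact: nearW.
  apply: (@cvgD _ R^o _ _ _ _ (cst r)); last exact: cvg_cst.
  exact: (cvg_comp _ _ (K_strong Dv_ Dv v_v) (@F_continuous (K v))).
rewrite -(cvg_limn_einf_sup FKv).2; apply: le_limn_esup => n.
rewrite /J_ asboolT; first by rewrite /J EFinD leeD2l.
have [c [u [c0 Bu vcu _]]] := vE n.
by exists c, u; split=> // j; case/andP: (c0 j).
Qed.

End GammaConvergence.

Theorem proposition3p6 (R : realType)
  (C : completeNormedModType R) (C_separable : separable C)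
  (Y : completeNormedModType R) (dotY : {dot Y for idfun})
  (normYE : forall y : Y, `|y| = Num.sqrt (dotY y y))
  (K : dual C -> Y) (F : Y -> R^o) (Reg : dual C -> \bar R)
  (Reg_ge0 : forall u, (0 <= Reg u)%E)
  (* (A1) *)
  (K_linear : linear K)
  (K_continuous : continuous (K : weakstar C -> weak Y))
  (* (A2) *)
  (F_bounded_below : exists m : R, forall y, m <= F y)
  (F_convex : convex_function setT F)
  (F_diff2 : twice_differentiable F)
  (* (A3) *)
  (Reg_convex : convex_functional Reg)
  (Reg_lsc : lower_semicontinuous (Reg : weakstar C -> \bar R))
  (Reg_hom : pos_homogeneous Reg)
  (* (A4) *)
  (Reg_compact : forall alpha : R, 0 <= alpha ->
    compact ([set u | (Reg u <= alpha%:E)%E] : set (weakstar C)))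
  (* (A5) *)
  (K_strong : forall (u_ : nat -> dual C) (u : dual C),
    (forall n, Dom Reg (u_ n)) -> Dom Reg u ->
    (u_ : nat -> weakstar C) @ \oo --> (u : weakstar C) ->
    (fun n => K (u_ n)) @ \oo --> K u) :
  (* Gamma-liminf *)
  (forall (v_ : nat -> dual C) (v : dual C),
    (forall n, Dom Reg (v_ n)) -> Dom Reg v ->
    (v_ : nat -> weakstar C) @ \oo --> (v : weakstar C) ->
    (J K F Reg v <= limn_einf (fun n => J_ K F Reg n (v_ n)))%E)
  /\
  (* Gamma-limsup *)
  (forall v : dual C, Dom Reg v ->
    exists v_ : nat -> dual C,
      [/\ forall n, Dom Reg (v_ n),
          (v_ : nat -> weakstar C) @ \oo --> (v : weakstar C),
          (limn_esup (fun n => J_ K F Reg n (v_ n)) <= J K F Reg v)%E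
        & forall n, (0 < n)%N ->
            exists (c : 'I_n -> R) (u : 'I_n -> dual C),
              [/\ forall j, 0 <= c j <= Num.sqrt (n%:R * fine (Reg v)),
                  forall j, Btilde Reg (u j),
                  v_ n = mean_field c u
                & ((n%:R^-1 * \sum_(j < n) (c j) ^+ 2)%:E <= Reg v)%E]]).
Proof.
have F_continuous : continuous F.
  by move=> y; case: F_diff2 => DF [dF _]; have [/differentiable_continuous] := dF y.
split=> [v_ v|v Dv]; first exact: Gamma_liminf.
have [v_ [Dv_ v_v Jv_ vE]] := Gamma_limsup Reg_ge0 F_continuous K_strong
  C_separable Reg_convex Reg_hom Reg_compact Dv.
by exists v_; split=> // n _; exact: vE.
Qed.
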